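(* Let $t=\{t_k\}_{k=1}^\infty$ be a non-increasing sequence of positive numbers, let $n\in\mathbb{N}$, $1\le q<p<\infty$ and $\varepsilon\ge 0$. Let $c_1,\ldots,c_n$ be the numbers defined in the context. 1. If $\varepsilon\le c_n$, then $$\mathcal{E}\left(W^T_q,I^n_{\varepsilon,p}\right)=\mathcal{E}\left(W^T_q,I^n_{\varepsilon,p},\Phi^*_n\right)=\left(t_{n+1}^q+\varepsilon^q\left(\sum_{j=1}^n\left(1-\frac{t_{n+1}^q}{t_j^q}\right)^{\frac{p}{p-q}}\right)^{\frac{p-q}{p}}\right)^{1/q}.$$ 2. If $\varepsilon\in(c_n,c_1]$, then there exist $m\in\{1,\ldots,n-1\}$ such that $\varepsilon\in(c_{m+1},c_m]$ and $\lambda=\lambda(\varepsilon)\in[0,1)$ such that $$\varepsilon=\left(\sum_{j=1}^{m}\left(1-\frac{t_{m,\lambda}^q}{t_j^q}\right)^{\frac{p}{p-q}}\right)^{\frac1p}\left(\sum_{j=1}^{m}\frac{1}{t_j^q}\left(1-\frac{t_{m,\lambda}^q}{t_j^q}\right)^{\frac{q}{p-q}}\right)^{-\frac1q}.$$ Then $$\mathcal{E}\left(W^T_q,I^n_{\varepsilon,p}\right)=\mathcal{E}\left(W^T_q,I^n_{\varepsilon,p},\Phi^*_{m,\lambda}\right)=\left(t_{m,\lambda}^q+\varepsilon^q\left(\sum_{j=1}^m\left(1-\frac{t_{m,\lambda}^q}{t_j^q}\right)^{\frac{p}{p-q}}\right)^{\frac{p-q}{p}}\right)^{1/q}.$$ 3.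 If $\varepsilon>c_1$, then $\mathcal{E}\left(W^T_q,I^n_{\varepsilon,p}\right)=\mathcal{E}\left(W^T_q,I^n_{\varepsilon,p},\Phi^*_0\right)=t_1$.
   Context: $\ell_q$ is the space of complex sequences $x=\{x_k\}_{k=1}^\infty$ with the usual norm $\|x\|_q$. The class is $W^T_q=\{x=Th : h\in\ell_q,\ \|h\|_q\le 1\}$, where $Th=\{t_kh_k\}_{k=1}^\infty$. Let $Z$ be a complex linear space, $W\subset\ell_q$, and let $I$ be an information mapping assigning to each $x$ a non-empty subset $I(x)\subset Z$. A method of recovery is an arbitrary mapping $\Phi:Z\to\ell_q$. Its error is $\mathcal{E}(W,I,\Phi)=\sup_{x\in W}\sup_{a\in I(x)}\|x-\Phi(a)\|_q$, and the error of optimal recovery is $\mathcal{E}(W,I)=\inf_{\Phi}\mathcal{E}(W,I,\Phi)$, the infimum being over all methods $\Phi:Z\to\ell_q$. Here $Z=\mathbb{C}^n$ and $I^n_{\varepsilon,p}(x)=\{a\in\mathbb{C}^n:(\sum_{k=1}^n|x_k-a_k|^p)^{1/p}\le\varepsilon\}$. Numbers $c_m$: put $\delta_{j,m}=\left(1-\frac{t_{m+1}^q}{t_j^q}\right)^{\frac{p}{p-q}}$ for $1\le j\le m\le n$; set $c_1:=t_1$ and, for $2\le m\le n$, $$c_m:=\left(\sum_{j=1}^m\delta_{j,m}\right)^{1/p}\left(\sum_{j=1}^m\frac{\delta_{j,m}^{q/p}}{t_j^q}\right)^{-1/q}.$$ For $\lambda\in[0,1]$, $t_{m,\lambda}\ge0$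 is defined by $t_{m,\lambda}^q:=(1-\lambda)t_{m+1}^q+\lambda t_m^q$. Methods: $$\Phi^*_n(a)=\left(a_1\Big(1-\frac{t_{n+1}^q}{t_1^q}\Big),\ldots,a_n\Big(1-\frac{t_{n+1}^q}{t_n^q}\Big),0,\ldots\right),$$ $$\Phi^*_{m,\lambda}(a)=\left(a_1\Big(1-\frac{t_{m,\lambda}^q}{t_1^q}\Big),\ldots,a_m\Big(1-\frac{t_{m,\lambda}^q}{t_m^q}\Big),0,\ldots\right),$$ and $\Phi^*_0(a)$ is the zero sequence.
   Formalization: In part 2 the existence claim for ε∈(c_{m+1},c_m] uses index m+1 (not m) in the equation, method and error, with λ∈(0,1]; if t_1=t_2, t_{m+1,λ}=t_1 may replace the equation. An undefined c_m (m≥2, t_1=t_{m+1}) is taken as 0. *)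

(* Defs.v *)
(* MathComp world: MathComp-Analysis and the complex numbers of real-closed. *)
From mathcomp Require Export all_boot all_order all_algebra.
From mathcomp Require Export complex.
From mathcomp Require Export all_classical all_reals all_analysis.
Set Implicit Arguments.
Unset Strict Implicit.
Unset Printing Implicit Defensive.
Import Order.TTheory GRing.Theory Num.Theory.
Import numFieldNormedType.Exports.
Local Open Scope classical_set_scope.
Local Open Scope ring_scope.
Local Open Scope complex_scope.

(* Sequences are indexed from 0: the value at k is the (k+1)-st term, so that
   t_j for 1 <= j <= m is [t j] for j < m, and t_(m+1) is [t m]. *)
Definition cseq (R : realType) := nat -> R[i].

(* [Normc.normc] is the R-valued modulus; the norm is +oo outside l_q. *)
Definition lq_norm (R : realType) (q : R) (x : cseq R) : \bar R :=
  ((\sum_(0 <= k <oo) ((Normc.normc (x k)) `^ q)%:E) `^ q^-1)%E.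

Definition lq (R : realType) (q : R) : set (cseq R) :=
  [set x | (lq_norm q x < +oo)%E].

Definition diag_op (R : realType) (t : nat -> R) (h : cseq R) : cseq R :=
  fun k => (t k)%:C * h k.

Definition W_class (R : realType) (q : R) (t : nat -> R) : set (cseq R) :=
  diag_op t @` [set h | lq q h /\ (lq_norm q h <= 1)%E].

Section Recovery.
Variables (R : realType) (q : R) (Z : lmodType R[i]).
Variables (W : set (cseq R)) (I : cseq R -> set Z).

Definition recovery_error (Phi : Z -> cseq R) : \bar R :=
  ereal_sup [set ereal_sup [set lq_norm q (fun k => x k - Phi a k) | a in I x]
            | x in W].

Definition optimal_error : \bar R :=
  ereal_inf [set recovery_error Phi | Phi in [set Phi | forall a, lq q (Phi a)]].

Definition optimal_with_error (Phi : Z -> cseq R) (v : R) : Prop :=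
  optimal_error = recovery_error Phi /\ recovery_error Phi = v%:E.

End Recovery.

Definition info (R : realType) (n : nat) (eps p : R) (x : cseq R) :
    set 'rV[R[i]]_n :=
  [set a | (\sum_(k < n) (Normc.normc (x k - a 0 k)) `^ p) `^ p^-1 <= eps].

Section Thresholds.
Variables (R : realType) (p q : R) (t : nat -> R).

(* delta_(j+1, m) *)
Definition delta (j m : nat) : R :=
  (1 - t m `^ q / t j `^ q) `^ (p / (p - q)).

(* c_m for m >= 1. When m >= 2 and t_1 = t_(m+1), both sums vanish and the
   formula is undefined as a real number; the convention 0 `^ r = 0 (r != 0)
   then gives 0. *)
Definition c (m : nat) : R :=
  if m == 1%N then t 0%N
  else (\sum_(j < m) delta j m) `^ p^-1
       * (\sum_(j < m) delta j m `^ (q / p) / t j `^ q) `^ (- q^-1).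

(* t_(m,lam) for m >= 1 *)
Definition t_interp (m : nat) (lam : R) : R :=
  ((1 - lam) * t m `^ q + lam * t m.-1 `^ q) `^ q^-1.

(* The radius associated with the threshold s = t_(m,lam). It equals c_m for
   lam = 0 and c_(m-1) for lam = 1 (m >= 2, t_m < t_1). When s = t_1 all terms
   vanish and the formula is undefined as a real number (0 * 0^(-1/q)). *)
Definition radius (m : nat) (s : R) : R :=
  (\sum_(j < m) (1 - s `^ q / t j `^ q) `^ (p / (p - q))) `^ p^-1
  * (\sum_(j < m) (t j `^ q)^-1
       * (1 - s `^ q / t j `^ q) `^ (q / (p - q))) `^ (- q^-1).

Definition error_value (eps : R) (m : nat) (s : R) : R :=
  (s `^ q + eps `^ q
    * (\sum_(j < m) (1 - s `^ q / t j `^ q) `^ (p / (p - q))) `^ ((p - q) / p))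
  `^ q^-1.

End Thresholds.

Section Methods.
Variables (R : realType) (q : R) (t : nat -> R) (n : nat).

(* Keeps the first m (<= n) coordinates, multiplied by 1 - s^q / t_j^q. *)
Definition shrink (m : nat) (s : R) (a : 'rV[R[i]]_n) : cseq R :=
  fun k => if insub k is Some i then
             if (k < m)%N then a 0 i * (1 - s `^ q / t k `^ q)%:C else 0
           else 0.

Definition Phi_full : 'rV[R[i]]_n -> cseq R := shrink n (t n).

Definition Phi_interp (m : nat) (lam : R) : 'rV[R[i]]_n -> cseq R :=
  shrink m (t_interp q t m lam).

Definition Phi_zero : 'rV[R[i]]_n -> cseq R := fun _ _ => 0.

End Methods.

(* Main.v *)
Require Import Defs.
From mathcomp Require Import lra ring.
Import Order.TTheory GRing.Theory Num.Theory.
Import numFieldNormedType.Exports.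
Local Open Scope ring_scope.
Set Implicit Arguments.
Unset Strict Implicit.
Unset Printing Implicit Defensive.

(** Write [w_j = 1 - s^q / t_j^q] for the factors of the method [shrink m s],
    where [t_m <= s <= t_(m-1)] in the 0-based indexing of [t].

    Upper bound. If [x = T h] and [a] is the observed vector, then
    [x_j - w_j a_j = (1 - w_j) x_j + w_j (x_j - a_j)], so convexity of [r^q]
    bounds the q-th power of the error at [j < m] by
    [s^q |h_j|^q + w_j |x_j - a_j|^q]; for [j >= m] it is [t_j^q |h_j|^q], at
    most [s^q |h_j|^q]. The first terms add up to at most [s^q] and Hoelder with
    exponents [p/(p-q)] and [p/q] bounds the others by
    [eps^q (sum w_j^(p/(p-q)))^((p-q)/p)]. The total is [error_value] to the
    power [q], for every [eps] ([recovery_error_shrink]).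

    Lower bound. If [x] and [-x] lie in the class and both admit the
    information [0], a method returns the same answer for both, so its error is
    at least the norm of [x] ([optimal_error_ge]). The equality case of Hoelder
    suggests [x_j] proportional to [w_j^(1/(p-q))] for [j < m], with
    [sum x_j^p = eps^p]. The corresponding [h] has [sum h_j^q = (eps/radius)^q].
    If this is 1, or if [m = n], [s = t_n] and the missing mass is put at the
    first unobserved coordinate [n], the norm of [x] is exactly [error_value]
    ([optimal_error_ge_extremal]).

    It remains to choose [s]. For [eps <= c_n], [s = t_n] works because [c_n] is
    [radius n (t n)]. For [c_n < eps <= c_1], let [i] be an index with
    [c_i < eps <= c_(i-1)]; the radius of [t_interp i lam] is [c_i] at [lam = 0],
    [c_(i-1)] at [lam = 1] and continuous, so it takes the value [eps]
    ([radius_interp_IVT]).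

    This breaks down when [t] starts with a plateau [t_0 = ... = t_(k-1)],
    where the radius degenerates as [s] tends to [t_0]. If [eps > c_k] with
    [k > 1] the first index after the plateau, the optimal error is already [t_0]:
    spreading the mass over the plateau as in the extremal sequence gives a
    vector of the class of norm [t_0] and of p-norm [c_k]
    ([optimal_error_ge_flat]), and then [m = 1], [lam = 1] are suitable. If the
    plateau contains the unobserved index [n], the n-th basis vector does the
    same. Otherwise [i] can be taken beyond the plateau, where all radii are
    positive. *)

(** * Inequalities for real powers *)

Lemma convex_powR2 (R : realType) (q u x y : R) :
  1 <= q -> 0 <= u <= 1 -> 0 <= x -> 0 <= y ->
  ((1 - u) * x + u * y) `^ q <= (1 - u) * x `^ q + u * y `^ q.
Proof.
move=> q1 /andP[u0 u1] x0 y0.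
have w0 : 0 <= 1 - u by rewrite subr_ge0.
have w1 : 1 - u <= 1 by rewrite gerBl.
have : ((1 - u) * x + (1 - (1 - u)) * y) `^ q
    <= (1 - u) * x `^ q + (1 - (1 - u)) * y `^ q.
  by apply: (convex_powR q1 (Itv01 w0 w1)); rewrite inE /= in_itv /= andbT.
by rewrite subKr.
Qed.

(** The two-term inequality [hoelder2] peels off the last term, its first pair
    of entries being the two norms of the partial families. *)
Lemma hoelder_sum (R : realType) (a b : nat -> R) (p q : R) (m : nat) :
  (forall k, (k < m)%N -> 0 <= a k) -> (forall k, (k < m)%N -> 0 <= b k) ->
  0 < p -> 0 < q -> p^-1 + q^-1 = 1 ->
  \sum_(k < m) a k * b k
    <= (\sum_(k < m) a k `^ p) `^ p^-1 * (\sum_(k < m) b k `^ q) `^ q^-1.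
Proof.
move=> + + p0 q0 pq; elim: m => [_ _|m IH a0 b0].
  by rewrite !big_ord0 mulr_ge0 ?powR_ge0.
rewrite !big_ord_recr /=.
have A0 : 0 <= \sum_(k < m) a k `^ p by apply: sumr_ge0 => *; exact: powR_ge0.
have B0 : 0 <= \sum_(k < m) b k `^ q by apply: sumr_ge0 => *; exact: powR_ge0.
have pK : p^-1 * p = 1 by rewrite mulVf ?gt_eqF.
have qK : q^-1 * q = 1 by rewrite mulVf ?gt_eqF.
have := @hoelder2 R ((\sum_(k < m) a k `^ p) `^ p^-1) (a m)
   ((\sum_(k < m) b k `^ q) `^ q^-1) (b m) p q.
rewrite -!powRrM pK qK !powRr1//.
move=> /(_ (powR_ge0 _ _) (a0 _ (ltnSn _)) (powR_ge0 _ _) (b0 _ (ltnSn _)) p0 q0 pq).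
apply: le_trans; rewrite lerD2r; apply: IH => k km;
  [apply: a0|apply: b0]; exact: ltnW.
Qed.

(** * The norm of l_q through partial sums *)

Lemma normc_real (R : realType) (r : R) : Normc.normc (r%:C)%C = `|r|.
Proof. by rewrite /Normc.normc /= expr0n /= addr0 sqrtr_sqr. Qed.

Lemma normc_ge0 (R : realType) (x : R[i]) : 0 <= Normc.normc x.
Proof. by case: x => a b; exact: sqrtr_ge0. Qed.

Section LqNorm.
Variables (R : realType) (q : R).
Hypothesis q_gt0 : 0 < q.
Implicit Types (x : cseq R) (v : R).

Let powRqK v : 0 <= v -> (v `^ q) `^ q^-1 = v.
Proof. by move=> v0; rewrite -powRrM mulfV ?gt_eqF// powRr1. Qed.

(** With [sum_le_lq_norm], reduces bounds on extended-real norms to bounds on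
    finite real sums. Partial sums only matter from some index [N] on, which lets
    [N] exceed the number of observed coordinates. *)
Lemma lq_norm_le x v (N : nat) : 0 <= v ->
  (forall n, (N <= n)%N -> \sum_(k < n) Normc.normc (x k) `^ q <= v `^ q) ->
  (lq_norm q x <= v%:E)%E.
Proof.
move=> v0 H; rewrite /lq_norm.
have pos k : (0 <= ((Normc.normc (x k)) `^ q)%:E)%E by rewrite lee_fin powR_ge0.
have S0 : (0 <= \sum_(0 <= k <oo) ((Normc.normc (x k)) `^ q)%:E)%E.
  by apply: nneseries_ge0.
have Sv : (\sum_(0 <= k <oo) ((Normc.normc (x k)) `^ q)%:E <= (v `^ q)%:E)%E.
  apply: lime_le; first by apply: is_cvg_nneseries => k _ _.
  by exists N => //= n /= Nn; rewrite big_mkord sumEFin lee_fin H.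
rewrite -[v in leRHS]powRqK// -poweR_EFin.
apply: gt0_ler_poweR => //; first by rewrite invr_ge0 ltW.
- by rewrite in_itv /= S0 leey.
- by rewrite in_itv /= leey lee_fin powR_ge0.
Qed.

Lemma sum_le_lq_norm x v (n : nat) : 0 <= v -> (lq_norm q x <= v%:E)%E ->
  \sum_(k < n) Normc.normc (x k) `^ q <= v `^ q.
Proof.
move=> v0; rewrite /lq_norm.
have pos k : (0 <= ((Normc.normc (x k)) `^ q)%:E)%E by rewrite lee_fin powR_ge0.
set S := (X in (X `^ _)%E) => H.
have S0 : (0 <= S)%E by apply: nneseries_ge0.
have := @nneseries_lim_ge R (fun k => ((Normc.normc (x k)) `^ q)%:E) xpredT 0 n
  (fun k _ _ => pos k).
rewrite big_mkord sumEFin -/S -lee_fin => /le_trans; apply.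
have := @gt0_ler_poweR _ q (ltW q_gt0) (S `^ q^-1)%E v%:E.
rewrite !in_itv/= !leey poweR_ge0 lee_fin v0 => /(_ isT isT H).
by rewrite -poweRrM mulVf ?gt_eqF// poweRe1// poweR_EFin.
Qed.

End LqNorm.

(** * Lower bounds for the optimal error *)

(** If [y] is the answer of a method to [a] and its error is [e], both [x - y]
    and [-x - y] have norm at most [e]. Since [x] is half the difference of the two,
    convexity of [r^q] applied coordinatewise gives norm at most [e] for [x], even
    on partial sums, so the triangle inequality of l_q can be avoided. *)
Lemma optimal_error_ge (R : realType) (q : R) (Z : lmodType R[i])
    (W : set (cseq R)) (I : cseq R -> set Z) (x : cseq R) (a : Z) (v : R) N :
  1 <= q -> W x -> W (fun k => - x k) -> I x a -> I (fun k => - x k) a ->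
  0 <= v -> v `^ q <= \sum_(k < N) Normc.normc (x k) `^ q ->
  (v%:E <= optimal_error q W I)%E.
Proof.
move=> q1 Wx WNx Ix INx v0 vx.
have q0 : 0 < q by exact: lt_le_trans q1.
apply: le_ereal_inf_tmp => _ [Phi _ <-].
have err y : W y -> I y a ->
    (lq_norm q (fun k => y k - Phi a k)%R <= recovery_error q W I Phi)%E.
  move=> Wy Iy; apply: le_trans; last by apply: ereal_sup_ubound; exists y.
  by apply: ereal_sup_ubound; exists a.
have e1 := err _ Wx Ix; have e2 := err _ WNx INx.
case E : (recovery_error q W I Phi) e1 e2 => [e| |]; last 2 first.
- by move=> _ _; rewrite leey.
- by move=> /(le_trans (poweR_ge0 _ _)).
move=> e1 e2.
have e0 : 0 <= e by rewrite -lee_fin; exact: le_trans (poweR_ge0 _ _) e1.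
rewrite lee_fin.
have := sum_le_lq_norm q0 N e0 e1; have := sum_le_lq_norm q0 N e0 e2 => s2 s1.
rewrite leNgt; apply/negP => ev.
have : v `^ q <= e `^ q.
  apply: (le_trans vx).
  have : \sum_(k < N) Normc.normc (x k) `^ q <=
      2^-1 * (\sum_(k < N) Normc.normc (x k - Phi a k) `^ q)
     + 2^-1 * (\sum_(k < N) Normc.normc (- x k - Phi a k) `^ q).
    rewrite !mulr_sumr -big_split /=; apply: ler_sum => k _.
    set u := x k; set w := Phi a k.
    have h : 0 <= (2^-1 : R) <= 1 by lra.
    have h' : 1 - 2^-1 = 2^-1 :> R by lra.
    have := convex_powR2 q1 h (normc_ge0 (u - w)) (normc_ge0 (- u - w)).
    rewrite h'; apply: le_trans; apply: ge0_ler_powR; rewrite ?nnegrE ?(ltW q0) ?normc_ge0//.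
      by rewrite addr_ge0// mulr_ge0 ?normc_ge0 ?invr_ge0.
    rewrite -mulrDr -ler_pdivrMl ?invrK; last by rewrite invr_gt0.
    have -> : Normc.normc (- u - w) = Normc.normc (u + w) by rewrite -opprD normcN.
    apply: le_trans (le_normcD _ _).
    have -> : ((u - w : Rcomplex R) + (u + w)) = u *+ 2 :> R[i] by ring.
    by rewrite normcMn mulr_natl.
  by move/le_trans; apply; lra.
by rewrite leNgt gt0_ltr_powR// nnegrE.
Qed.

(** The symmetric pair is [T h] and [- T h] for a finitely supported nonnegative
    real [h]; the shared information is the zero vector. *)
Lemma optimal_error_ge_seq (R : realType) (p q eps : R) (t h : nat -> R) (n N : nat) :
  1 <= q -> 0 < p -> 0 <= eps -> (forall k, 0 <= t k) -> (forall k, 0 <= h k) ->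
  (forall k, (N <= k)%N -> h k = 0) ->
  \sum_(k < N) h k `^ q <= 1 -> \sum_(k < n) (t k * h k) `^ p <= eps `^ p ->
  (((\sum_(k < N) (t k * h k) `^ q) `^ q^-1)%:E
    <= optimal_error q (W_class q t) (@info R n eps p))%E.
Proof.
move=> q1 p0 eps0 t0 h0 hN hq hp.
have q0 : 0 < q by exact: lt_le_trans q1.
pose g k : R[i] := ((h k)%:C)%C.
have ng k : Normc.normc (g k) = h k by rewrite normc_real ger0_norm.
have nx k : Normc.normc (diag_op t g k) = t k * h k.
  by rewrite Normc.normcM normc_real ng ger0_norm.
have ball (g' : cseq R) : (forall k, Normc.normc (g' k) = h k) -> W_class q t (diag_op t g').
  move=> g'h; have le1 : (lq_norm q g' <= 1%:E)%E.
    apply: (@lq_norm_le _ _ q0 _ _ N) => // j Nj; rewrite powR1.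
    under eq_bigr do rewrite g'h.
    apply: le_trans hq.
    rewrite (big_ord_widen _ (fun k => h k `^ q) Nj) big_mkcond /=.
    rewrite [leRHS]big_mkcond /=; apply: ler_sum => k _.
    case: ltnP => // /hN ->; by rewrite powR0// gt_eqF.
  exists g' => //; split => //; exact: le_lt_trans le1 (ltry _).
have inf0 x : (forall k, Normc.normc (x k) = t k * h k) -> info eps p x (0 : 'rV[R[i]]_n).
  move=> xh; rewrite /info /=; under eq_bigr do rewrite mxE subr0 xh.
  rewrite -[leRHS](powRr1 eps0) -(@mulfV _ p) ?gt_eqF// powRrM.
  apply: ge0_ler_powR; rewrite ?nnegrE ?invr_ge0 ?powR_ge0 ?(ltW p0)//.
  by apply: sumr_ge0 => *; exact: powR_ge0.
apply: (@optimal_error_ge _ _ _ _ _ (diag_op t g) 0 _ N) => //.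
- exact: ball.
- have -> : (fun k => - diag_op t g k) = diag_op t (fun k => - g k).
    by apply/funext => k; rewrite /diag_op mulrN.
  by apply: ball => k; rewrite normcN.
- exact: inf0.
- by apply: inf0 => k; rewrite normcN.
- exact: powR_ge0.
- under [leRHS]eq_bigr do rewrite nx.
  rewrite -powRrM mulVf ?gt_eqF// powRr1//.
  by apply: sumr_ge0 => *; exact: powR_ge0.
Qed.

(** * The error of the shrinking methods *)

Section Upper.
Variables (R : realType) (p q : R) (t : nat -> R).
Hypotheses (t_pos : forall k, 0 < t k) (q_ge1 : 1 <= q) (q_lt_p : q < p).

Let q_gt0 : 0 < q. Proof. exact: lt_le_trans q_ge1. Qed.
Let p_gt0 : 0 < p. Proof. exact: lt_trans q_lt_p. Qed.

(** The factor by which [shrink] multiplies the entry [j] that it keeps. *)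
Definition weight (s : R) (j : nat) : R := 1 - s `^ q / t j `^ q.

Lemma weight_itv s j : 0 <= s -> s <= t j -> 0 <= weight s j <= 1.
Proof.
move=> s0 st; have tq : 0 < t j `^ q by exact: powR_gt0.
rewrite /weight subr_ge0 ler_pdivrMr// mul1r gerBl divr_ge0 ?powR_ge0// andbT.
by apply: ge0_ler_powR; rewrite ?nnegrE ?(ltW q_gt0) ?(ltW (t_pos j)).
Qed.

Lemma error_value_ge0 eps m s : 0 <= error_value p q t eps m s.
Proof. exact: powR_ge0. Qed.

Lemma error_valueK eps m s : error_value p q t eps m s `^ q =
  s `^ q + eps `^ q
    * (\sum_(j < m) weight s j `^ (p / (p - q))) `^ ((p - q) / p).
Proof.
rewrite /error_value -powRrM mulVf ?gt_eqF// powRr1//.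
by rewrite addr_ge0 ?mulr_ge0 ?powR_ge0.
Qed.

Lemma hoelder_weight (b : nat -> R) m s eps : 0 <= s -> 0 <= eps ->
  (forall k, (k < m)%N -> s <= t k) -> (forall k, 0 <= b k) ->
  \sum_(k < m) b k `^ p <= eps `^ p ->
  \sum_(k < m) weight s k * b k `^ q
    <= eps `^ q * (\sum_(j < m) weight s j `^ (p / (p - q))) `^ ((p - q) / p).
Proof.
move=> s0 eps0 st b0 bp.
have pq0 : 0 < p - q by rewrite subr_gt0.
have -> : eps `^ q = (eps `^ p) `^ (q / p).
  by rewrite -powRrM mulrCA mulfV ?gt_eqF// mulr1.
apply: le_trans (@hoelder_sum R (weight s) (fun k => b k `^ q)
  (p / (p - q)) (p / q) m _ _ _ _ _) _; rewrite ?invf_div.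
- by move=> k km; case/andP: (weight_itv s0 (st _ km)).
- by move=> *; exact: powR_ge0.
- exact: divr_gt0.
- exact: divr_gt0.
- by rewrite -mulrDl subrK divff// gt_eqF.
rewrite mulrC; apply: ler_wpM2r; first exact: powR_ge0.
under eq_bigr do rewrite -powRrM mulrCA mulfV ?gt_eqF// mulr1.
apply: ge0_ler_powR; rewrite ?nnegrE ?powR_ge0 ?divr_ge0 ?(ltW q_gt0) ?(ltW p_gt0)//.
by apply: sumr_ge0 => *; exact: powR_ge0.
Qed.

(** Convexity splits each kept term into a part of the mass of [h] and a part of the
    observation error; the discarded terms are absorbed by the mass, as [t k <= s]
    for [m <= k]. *)
Lemma recovery_error_shrink (m n : nat) (s eps : R) : (m <= n)%N -> 0 <= s ->
  (forall k, (k < m)%N -> s <= t k) -> (forall k, (m <= k)%N -> t k <= s) ->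
  0 <= eps ->
  (recovery_error q (W_class q t) (@info R n eps p) (@shrink R q t n m s)
    <= (error_value p q t eps m s)%:E)%E.
Proof.
move=> mn s0 st ts eps0.
apply: ge_ereal_sup => _ [_ [h [_ h1] <-] <-].
apply: ge_ereal_sup => _ [a xa <-].
set x := diag_op t h in xa *.
(* [b k] is the size of the observation error at [k], as a function on [nat]. *)
pose b k := if insub k is Some i then Normc.normc (x k - a 0 (i : 'I_n)) else 0.
have b0 k : 0 <= b k by rewrite /b; case: insubP => // *; exact: normc_ge0.
have bp : \sum_(k < m) b k `^ p <= eps `^ p.
  have : \sum_(k < n) b k `^ p <= eps `^ p.
    have := @ge0_ler_powR R p (ltW p_gt0) _ _ _ _ xa; rewrite !nnegrE powR_ge0.
    move=> /(_ isT eps0); rewrite -powRrM mulVf ?gt_eqF// powRr1; last first.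
      by apply: sumr_ge0 => *; exact: powR_ge0.
    by under [in X in _ -> X]eq_bigr do rewrite /b valK.
  apply: le_trans; rewrite (big_ord_widen _ (fun k => b k `^ p) mn) big_mkcond /=.
  by apply: ler_sum => k _; case: ifP => // _; exact: powR_ge0.
apply: (@lq_norm_le _ _ q_gt0 _ _ n); first exact: error_value_ge0.
move=> N nN; rewrite error_valueK.
have hN : \sum_(k < N) Normc.normc (h k) `^ q <= 1.
  by have := @sum_le_lq_norm R q q_gt0 h 1 N ler01 h1; rewrite powR1.
apply: (@le_trans _ _ (s `^ q * \sum_(k < N) Normc.normc (h k) `^ q
   + \sum_(k < m) weight s k * b k `^ q)); last first.
  apply: lerD; last exact: hoelder_weight.
  by rewrite ler_piMr// powR_ge0.
rewrite (big_ord_widen _ (fun k => weight s k * b k `^ q) (leq_trans mn nN)).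
rewrite [X in _ <= _ + X]big_mkcond mulr_sumr -big_split /=; apply: ler_sum => k _.
have nx : Normc.normc (x k) = t k * Normc.normc (h k).
  by rewrite Normc.normcM normc_real ger0_norm// ltW.
have nxq : Normc.normc (x k) `^ q = t k `^ q * Normc.normc (h k) `^ q.
  by rewrite nx powRM ?normc_ge0// ltW.
have tq : 0 < t k `^ q by exact: powR_gt0.
case: ltnP => [km|mk]; last first.
  have -> : shrink q t m s a k = 0.
    by rewrite /shrink ltnNge mk; case: insub.
  rewrite subr0 addr0 nxq; apply: ler_wpM2r; first exact: powR_ge0.
  by apply: ge0_ler_powR; rewrite ?nnegrE ?(ltW q_gt0) ?(ltW (t_pos _)) ?ts.
have kn : (k < n)%N by exact: leq_trans mn.
rewrite /shrink /b km insubT /=; set i := Sub _ _.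
rewrite -/(weight s k); have w01 := weight_itv s0 (st _ km).
have -> : s `^ q * Normc.normc (h k) `^ q = (1 - weight s k) * Normc.normc (x k) `^ q.
  by rewrite nxq /weight subKr; field; rewrite gt_eqF.
apply: le_trans (convex_powR2 q_ge1 w01 (normc_ge0 _) (normc_ge0 _)).
case/andP: w01 => w0 w1; have w1' : 0 <= 1 - weight s k by rewrite subr_ge0.
apply: ge0_ler_powR; rewrite ?nnegrE ?(ltW q_gt0) ?normc_ge0//.
  by rewrite addr_ge0// mulr_ge0 ?normc_ge0// subr_ge0.
have -> : x k - a 0 i * ((weight s k)%:C)%C =
    ((1 - weight s k)%:C)%C * x k + ((weight s k)%:C)%C * (x k - a 0 i).
  by move: (weight s k) => w; rewrite rmorphB rmorph1 /=; ring.
apply: le_trans (le_normcD _ _) _.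
by rewrite !Normc.normcM !normc_real !ger0_norm// ?(ltW (t_pos k)).
Qed.

Lemma shrink_lq (n m : nat) (s : R) (a : 'rV[R[i]]_n) : lq q (shrink q t m s a).
Proof.
set x := shrink q t m s a.
set S := \sum_(k < n) Normc.normc (x k) `^ q.
have S0 : 0 <= S by apply: sumr_ge0 => *; exact: powR_ge0.
apply: (@le_lt_trans _ _ ((S `^ q^-1)%:E)); last exact: ltry.
apply: (@lq_norm_le _ _ q_gt0 _ _ n); first exact: powR_ge0.
move=> N nN; rewrite -powRrM mulVf ?gt_eqF// powRr1//.
rewrite /S (big_ord_widen _ (fun k => Normc.normc (x k) `^ q) nN).
rewrite [leRHS]big_mkcond /=; apply: ler_sum => k _.
case: ltnP => // nk; rewrite /x /shrink insubF; last by rewrite ltnNge nk.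
by rewrite Normc.normc0 powR0// gt_eqF.
Qed.

(** Upper and lower bounds meet, so the optimal error and the error of the method
    are both squeezed to the same value. *)
Lemma optimal_with_error_shrink (m n : nat) (s eps : R) : (m <= n)%N -> 0 <= s ->
  (forall k, (k < m)%N -> s <= t k) -> (forall k, (m <= k)%N -> t k <= s) ->
  0 <= eps ->
  ((error_value p q t eps m s)%:E <= optimal_error q (W_class q t) (@info R n eps p))%E ->
  optimal_with_error q (W_class q t) (@info R n eps p) (@shrink R q t n m s)
    (error_value p q t eps m s).
Proof.
move=> mn s0 st ts eps0 lower.
have upper := recovery_error_shrink mn s0 st ts eps0.
have opt : (optimal_error q (W_class q t) (@info R n eps p) <=
    recovery_error q (W_class q t) (@info R n eps p) (@shrink R q t n m s))%E.
  by apply: ereal_inf_lbound; exists (@shrink R q t n m s) => // a; exact: shrink_lq.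
split; apply/eqP; rewrite eq_le.
- by rewrite opt (le_trans upper).
- by rewrite upper (le_trans lower).
Qed.

End Upper.

(** * Thresholds and radii *)

Section Radius.
Variables (R : realType) (p q : R) (t : nat -> R).
Hypotheses (t_pos : forall k, 0 < t k) (t_noninc : nonincreasing_seq t).
Hypotheses (q_ge1 : 1 <= q) (q_lt_p : q < p).

Let q_gt0 : 0 < q. Proof. exact: lt_le_trans q_ge1. Qed.
Let p_gt0 : 0 < p. Proof. exact: lt_trans q_lt_p. Qed.
Let pq_gt0 : 0 < p - q. Proof. by rewrite subr_gt0. Qed.

Definition delta_sum (m : nat) (s : R) : R :=
  \sum_(j < m) weight q t s j `^ (p / (p - q)).

Definition mass_sum (m : nat) (s : R) : R :=
  \sum_(j < m) (t j `^ q)^-1 * weight q t s j `^ (q / (p - q)).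

Lemma radiusE m s :
  radius p q t m s = delta_sum m s `^ p^-1 * mass_sum m s `^ (- q^-1).
Proof. by []. Qed.

Lemma weight_gt0 s : 0 <= s -> s < t 0%N -> 0 < weight q t s 0.
Proof.
move=> s0 st; rewrite subr_gt0 ltr_pdivrMr ?powR_gt0// mul1r.
by apply: gt0_ltr_powR; rewrite ?nnegrE ?(ltW (t_pos 0)).
Qed.

Lemma delta_sum_gt0 m s : (0 < m)%N -> 0 <= s -> s < t 0%N -> 0 < delta_sum m s.
Proof.
case: m => // m _ s0 st; rewrite /delta_sum big_ord_recl /=.
by rewrite ltr_pwDl ?powR_gt0 ?weight_gt0// sumr_ge0// => *; exact: powR_ge0.
Qed.

Lemma mass_sum_gt0 m s : (0 < m)%N -> 0 <= s -> s < t 0%N -> 0 < mass_sum m s.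
Proof.
case: m => // m _ s0 st; rewrite /mass_sum big_ord_recl /=.
rewrite ltr_pwDl ?mulr_gt0 ?invr_gt0 ?powR_gt0 ?weight_gt0// sumr_ge0// => *.
by rewrite mulr_ge0 ?invr_ge0 ?powR_ge0.
Qed.

Lemma radius_gt0 m s : (0 < m)%N -> 0 <= s -> s < t 0%N -> 0 < radius p q t m s.
Proof.
by move=> m0 s0 st; rewrite radiusE mulr_gt0 ?powR_gt0 ?delta_sum_gt0 ?mass_sum_gt0.
Qed.

Lemma weight_eq0 j : weight q t (t j) j = 0.
Proof. by rewrite /weight divff ?subrr// gt_eqF// powR_gt0. Qed.

Lemma t_le0 j : t j <= t 0%N. Proof. exact: t_noninc. Qed.

Lemma delta_sum_top m : (forall k, (k < m)%N -> t k = t 0%N) ->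
  delta_sum m (t 0%N) = 0.
Proof.
move=> tm; rewrite /delta_sum big1// => k _.
by rewrite -{1}(tm k)// weight_eq0 powR0// mulf_neq0 ?invr_eq0 ?gt_eqF.
Qed.

Lemma radius_top m : (forall k, (k < m)%N -> t k = t 0%N) ->
  radius p q t m (t 0%N) = 0.
Proof.
move=> tm; rewrite radiusE delta_sum_top// powR0 ?mul0r//.
by rewrite invr_eq0 gt_eqF.
Qed.

Lemma error_value_top eps m : (forall k, (k < m)%N -> t k = t 0%N) ->
  error_value p q t eps m (t 0%N) = t 0%N.
Proof.
move=> tm; rewrite /error_value -/(delta_sum m (t 0%N)) delta_sum_top// powR0.
  by rewrite mulr0 addr0 -powRrM mulfV ?gt_eqF// powRr1// ltW.
by rewrite mulf_neq0 ?invr_eq0 ?gt_eqF.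
Qed.

(** The new term has weight 0 at [s = t m], so the radii for [m.+1] and [m] agree at
    the common endpoint of their ranges of [s]. *)
Lemma radius_succ m : (0 < m)%N -> radius p q t m.+1 (t m) = radius p q t m (t m).
Proof.
move=> m0; rewrite !radiusE /delta_sum /mass_sum !big_ord_recr /= weight_eq0.
by rewrite !powR0 ?mulr0 ?addr0// mulf_neq0 ?invr_eq0 ?gt_eqF.
Qed.

(** For [m = 1] the two sums have one term each and the powers of its weight
    cancel, which leaves the prescribed value [t 0]. *)
Lemma c_eq_radius m : (0 < m)%N -> t m < t 0%N -> c p q t m = radius p q t m (t m).
Proof.
move=> m0 tm; rewrite /c; case: eqP => [m1|_].
  rewrite radiusE m1 in tm *; rewrite /delta_sum /mass_sum !big_ord1.
  have w0 := weight_gt0 (ltW (t_pos _)) tm.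
  rewrite [(_^-1 * _) `^ _]powRM ?powR_ge0 ?invr_ge0 ?powR_ge0//.
  rewrite -powRN -!powRrM /=.
  have -> : - q * - q^-1 = 1 by field; rewrite gt_eqF.
  rewrite powRr1 ?(ltW (t_pos 0))// mulrCA -powRD; last first.
    by rewrite (gt_eqF w0) implybT.
  have -> : p / (p - q) / p + q / (p - q) * - q^-1 = 0 by field; rewrite !gt_eqF.
  by rewrite powRr0 mulr1.
rewrite radiusE /delta_sum /mass_sum; congr (_ * _ `^ _).
apply: eq_bigr => j _; rewrite /delta -powRrM mulrC; congr (_ * _ `^ _).
by field; rewrite !gt_eqF.
Qed.

Lemma c_ge0 m : 0 <= c p q t m.
Proof. by rewrite /c; case: ifP => _; [exact: ltW|rewrite mulr_ge0 ?powR_ge0]. Qed.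

(** On an initial plateau the formula is degenerate and takes the value 0
    through the convention on powers of 0. *)
Lemma c_top m : (1 < m)%N -> t m = t 0%N -> c p q t m = 0.
Proof.
move=> m1 tm; rewrite /c gtn_eqF// [X in X `^ _]big1 => [|j _]; last first.
  have -> : delta p q t j m = weight q t (t m) j `^ (p / (p - q)) by [].
  have -> : t m = t j by apply/le_anti; rewrite {2}tm t_le0 andbT t_noninc// ltnW.
  by rewrite weight_eq0 powR0// mulf_neq0 ?invr_eq0 ?gt_eqF.
by rewrite powR0 ?mul0r// invr_eq0 gt_eqF.
Qed.

(** * The extremal sequence *)

Section Extremal.
Variables (m : nat) (s : R).
Hypotheses (m_gt0 : (0 < m)%N) (s_ge0 : 0 <= s) (s_lt : s < t 0%N).
Hypothesis s_le : forall k, (k < m)%N -> s <= t k.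

(** The entries [h_k] for which [T h] is the equality case of Hoelder in
    [hoelder_weight], scaled to have p-norm [e]. *)
Definition extremal (e : R) (k : nat) : R :=
  e * weight q t s k `^ (p - q)^-1 * delta_sum m s `^ (- p^-1) / t k.

Let A_gt0 : 0 < delta_sum m s. Proof. exact: delta_sum_gt0. Qed.
Let B_gt0 : 0 < mass_sum m s. Proof. exact: mass_sum_gt0. Qed.

Lemma extremal_ge0 e k : 0 <= e -> 0 <= extremal e k.
Proof. by move=> e0; rewrite /extremal !mulr_ge0 ?powR_ge0 ?invr_ge0// ltW. Qed.

Lemma extremal_powR e k r : 0 <= e -> (t k * extremal e k) `^ r =
  e `^ r * delta_sum m s `^ (- (r / p)) * weight q t s k `^ (r / (p - q)).
Proof.
move=> e0; rewrite /extremal mulrC divfK ?gt_eqF//.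
rewrite !powRM ?mulr_ge0 ?powR_ge0// -!powRrM mulNr mulrAC.
by rewrite ![_^-1 * r]mulrC.
Qed.

Lemma sum_extremal_p e : 0 <= e ->
  \sum_(k < m) (t k * extremal e k) `^ p = e `^ p.
Proof.
move=> e0; under eq_bigr do rewrite extremal_powR//.
rewrite -mulr_sumr -/(delta_sum m s) divff ?gt_eqF// -mulrA.
by rewrite powR_inv1 ?(ltW A_gt0)// mulVf ?mulr1// gt_eqF.
Qed.

(** This identity is the meaning of [radius]: the largest [e] for which the
    extremal sequence stays in the unit ball. *)
Lemma sum_extremal_mass e : 0 <= e ->
  \sum_(k < m) extremal e k `^ q = (e / radius p q t m s) `^ q.
Proof.
move=> e0.
have E k : extremal e k `^ q = e `^ q * delta_sum m s `^ (- (q / p)) *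
    ((t k `^ q)^-1 * weight q t s k `^ (q / (p - q))).
  rewrite -[extremal e k](mulKf (lt0r_neq0 (t_pos k))).
  have tk := ltW (t_pos k); have tx := mulr_ge0 tk (extremal_ge0 k e0).
  rewrite powRM ?invr_ge0// extremal_powR// -(powR_inv1 tk) -powRrM mulN1r.
  by rewrite (powRN (t k)) mulrCA.
under eq_bigr do rewrite E; rewrite -mulr_sumr -/(mass_sum m s) radiusE.
rewrite invfM !powRM ?invr_ge0 ?mulr_ge0 ?invr_ge0 ?powR_ge0// -!powRN -!powRrM opprK.
by rewrite mulVf ?gt_eqF// powRr1 ?ltW// mulNr mulrA [_^-1 * q]mulrC.
Qed.

(** The exponent [q/(p-q)] of the weight becomes [p/(p-q)] after one more factor,
    so the sum collapses to [delta_sum]. *)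
Lemma sum_extremal_weight e : 0 <= e ->
  \sum_(k < m) (t k * extremal e k) `^ q * weight q t s k =
  e `^ q * delta_sum m s `^ ((p - q) / p).
Proof.
move=> e0.
have E k : (k < m)%N -> (t k * extremal e k) `^ q * weight q t s k =
    e `^ q * delta_sum m s `^ (- (q / p)) * weight q t s k `^ (p / (p - q)).
  move=> km; rewrite extremal_powR// -mulrA; congr (_ * _).
  have /andP[w0 _] := weight_itv t_pos q_ge1 s_ge0 (s_le km).
  rewrite -[X in _ * X](powRr1 w0) -powRD; last first.
    by rewrite gt_eqF// addr_gt0 ?divr_gt0.
  by congr (_ `^ _); field; rewrite gt_eqF.
rewrite (eq_bigr _ (fun (k : 'I_m) _ => E k (ltn_ord k))) -mulr_sumr -/(delta_sum m s) -mulrA.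
rewrite -[X in _ * (_ * X)]powRr1 ?(ltW A_gt0)// -powRD; last first.
  by rewrite (gt_eqF A_gt0) implybT.
by congr (_ * _ `^ _); field; rewrite gt_eqF.
Qed.

End Extremal.

(** Put the mass [1 - sigma] that the extremal sequence leaves unused at coordinate
    [n]. It contributes [t_n^q (1 - sigma)], and this equals [s^q (1 - sigma)] in
    both cases of the disjunction: either nothing is left or [s = t_n]. Adding
    [sum (t_k h_k)^q = s^q sigma + sum w_k (t_k h_k)^q] gives [error_value]. *)
Lemma optimal_error_ge_extremal n m s eps : (0 < m <= n)%N -> 0 <= s -> s < t 0%N ->
  (forall k, (k < m)%N -> s <= t k) -> 0 <= eps -> eps <= radius p q t m s ->
  (eps = radius p q t m s) \/ (m = n /\ s = t n) ->
  ((error_value p q t eps m s)%:E <=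
    optimal_error q (W_class q t) (@info R n eps p))%E.
Proof.
move=> /andP[m0 mn] s0 st sle eps0 epsr edge.
have r0 := radius_gt0 m0 s0 st.
set ext := extremal m s eps.
have ext0 k : 0 <= ext k by exact: extremal_ge0.
set sigma := \sum_(k < m) ext k `^ q.
have sigmaE : sigma = (eps / radius p q t m s) `^ q by exact: sum_extremal_mass.
have sigma1 : sigma <= 1.
  have one : 1 `^ q = 1 :> R by rewrite powR1.
  rewrite sigmaE -[leRHS]one; apply: ge0_ler_powR; rewrite ?nnegrE ?(ltW q_gt0)//.
    by rewrite divr_ge0// ltW.
  by rewrite ler_pdivrMr// mul1r.
have edge' : t n `^ q * (1 - sigma) = s `^ q * (1 - sigma).
  case: edge => [e|[_ ->]//].
  by rewrite sigmaE e divff ?gt_eqF// powR1 subrr !mulr0.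
pose rest := (1 - sigma) `^ q^-1.
have restq : rest `^ q = 1 - sigma.
  by rewrite -powRrM mulVf ?gt_eqF// powRr1// subr_ge0.
pose h k := if (k < m)%N then ext k else if k == n then rest else 0.
have h0 k : 0 <= h k by rewrite /h; case: ifP => // _; case: ifP => // _; exact: powR_ge0.
have sumh (f : nat -> R -> R) : (forall k, f k 0 = 0) -> forall N, (m <= N <= n)%N ->
    \sum_(k < N) f k (h k) = \sum_(k < m) f k (ext k).
  move=> f0 N /andP[mN Nn]; rewrite [RHS](big_ord_widen _ (fun k => f k (ext k)) mN).
  rewrite [RHS]big_mkcond; apply: eq_bigr => k _ /=; rewrite /h; case: ifP => // _.
  by rewrite ltn_eqF// (leq_trans (ltn_ord k)).
have hn : h n = rest by rewrite /h ltnNge mn eqxx.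
have pow0 (r : R) : 0 < r -> 0 `^ r = 0 :> R by move=> r'; rewrite powR0// gt_eqF.
have mnn : (m <= n <= n)%N by rewrite mn leqnn.
have := @optimal_error_ge_seq R p q eps t h n n.+1 q_ge1 p_gt0 eps0
  (fun k => ltW (t_pos k)) h0.
rewrite !big_ord_recr /= hn.
rewrite (sumh (fun _ x => x `^ q)) ?mnn//; last by move=> _; exact: pow0.
rewrite (sumh (fun k x => (t k * x) `^ q)) ?mnn//; last first.
  by move=> k; rewrite mulr0 pow0.
rewrite (sumh (fun k x => (t k * x) `^ p)) ?mnn//; last first.
  by move=> k; rewrite mulr0 pow0.
rewrite sum_extremal_p// restq -/sigma subrKC.
have -> : \sum_(k < m) (t k * ext k) `^ q + (t n * rest) `^ q =
    s `^ q + eps `^ q * delta_sum m s `^ ((p - q) / p).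
  rewrite powRM ?powR_ge0 ?(ltW (t_pos _))// restq edge'.
  rewrite -(sum_extremal_weight m0 s0 st sle eps0).
  have -> : s `^ q * (1 - sigma) = s `^ q - \sum_(k < m) s `^ q * ext k `^ q.
    by rewrite mulrBr mulr1 mulr_sumr.
  rewrite addrCA; congr (_ + _); rewrite -sumrB; apply: eq_bigr => k _.
  rewrite -/ext powRM ?(ltW (t_pos _))// /weight; field.
  by rewrite gt_eqF// powR_gt0.
move=> H; apply: H => //.
by move=> k nk; rewrite /h ltnNge (leq_trans mn (ltnW nk)) /= gtn_eqF.
Qed.

(** Where [t] is constant, [T] multiplies norms by [t 0], so the extremal sequence
    of mass 1 yields norm [t 0] for any [s]; only its p-norm, the radius, has to
    be within the information error. *)
Lemma optimal_error_ge_flat n m s eps : (0 < m <= n)%N -> 0 <= s -> s < t 0%N ->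
  (forall k, (k < m)%N -> t k = t 0%N) -> radius p q t m s <= eps ->
  ((t 0%N)%:E <= optimal_error q (W_class q t) (@info R n eps p))%E.
Proof.
move=> /andP[m0 mn] s0 st flat reps.
have r0 := radius_gt0 m0 s0 st.
have eps0 : 0 <= eps by rewrite (le_trans _ reps)// ltW.
set ext := extremal m s (radius p q t m s).
pose h k := if (k < m)%N then ext k else 0.
have h0 k : 0 <= h k.
  by rewrite /h; case: ifP => // _; apply: extremal_ge0; exact: ltW.
have hE k : (k < m)%N -> h k = ext k by rewrite /h => ->.
have sig : \sum_(k < m) h k `^ q = 1.
  under eq_bigr do rewrite hE//.
  by rewrite sum_extremal_mass// ?ltW// divff ?gt_eqF// powR1.
have -> : t 0%N = (\sum_(k < m) (t k * h k) `^ q) `^ q^-1.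
  under eq_bigr do rewrite flat// powRM ?h0 ?(ltW (t_pos _))//.
  by rewrite -mulr_sumr sig mulr1 -powRrM mulfV ?gt_eqF// powRr1// ltW.
apply: optimal_error_ge_seq => //.
- by move=> k; exact: ltW.
- by move=> k mk; rewrite /h ltnNge mk.
- by rewrite sig.
have -> : \sum_(k < n) (t k * h k) `^ p = radius p q t m s `^ p.
  rewrite -(sum_extremal_p m0 s0 st (ltW r0)).
  rewrite [RHS](big_ord_widen _ (fun k => (t k * ext k) `^ p) mn) [RHS]big_mkcond /=.
  apply: eq_bigr => k _; rewrite /h; case: ifP => // _.
  by rewrite mulr0 powR0// gt_eqF.
by apply: ge0_ler_powR; rewrite ?nnegrE ?(ltW p_gt0) ?(ltW r0).
Qed.

(** A basis vector is invisible if its index is not observed or if its size is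
    below the information error. *)
Lemma optimal_error_ge_single n j eps : 0 <= eps -> (n <= j)%N \/ t j <= eps ->
  ((t j)%:E <= optimal_error q (W_class q t) (@info R n eps p))%E.
Proof.
move=> eps0 je.
pose h k : R := if k == j then 1 else 0.
have sumh N (a : nat -> R) r : 0 < r ->
    \sum_(k < N) (a k * h k) `^ r = if (j < N)%N then a j `^ r else 0.
  move=> r0; elim: N => [|N IH]; first by rewrite big_ord0.
  rewrite big_ord_recr /= IH /h [in RHS]ltnS [in RHS]leq_eqVlt.
    rewrite [j == N]eq_sym; case: (eqVneq N j) => [->|Nj] /=.
      by rewrite ltnn add0r mulr1.
  by rewrite mulr0 powR0 ?gt_eqF// addr0.
have h0 k : 0 <= h k by rewrite /h; case: ifP.
have -> : t j = (\sum_(k < j.+1) (t k * h k) `^ q) `^ q^-1.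
  by rewrite sumh// ltnSn -powRrM mulfV ?gt_eqF// powRr1// ltW.
apply: optimal_error_ge_seq => //.
- by move=> k; exact: ltW.
- by move=> k jk; rewrite /h gtn_eqF.
- under eq_bigr do rewrite -[h _]mul1r.
  by rewrite (sumh _ (fun=> 1))// ltnSn powR1.
rewrite sumh//; case: ltnP => [jn|_]; last exact: powR_ge0.
case: je => [|je]; first by rewrite leqNgt jn.
by apply: ge0_ler_powR; rewrite ?nnegrE ?(ltW p_gt0) ?(ltW (t_pos _)).
Qed.

End Radius.

(** * Reaching every radius by interpolation *)

Section Continuity.
Local Open Scope classical_set_scope.

Lemma cvg_powR (R : realType) (T : Type) (F : set_system T) (f : T -> R) (l r : R) :
  0 < l -> f x @[x --> F] --> l -> f x `^ r @[x --> F] --> l `^ r.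
Proof.
move=> l0 fl; apply: (@cvg_comp _ _ _ f (fun y => y `^ r) F (nbhs l)) => //.
have d : differentiable (fun y : R => y `^ r) l.
  apply/derivable1_diffP.
  exact: (@ex_derive _ _ _ _ _ _ _ (is_derive1_powR r l0)).
exact: (differentiable_continuous d).
Qed.

(** Taking positive parts makes the power continuous on the whole line, across
    the point 0 that the last weight reaches at [lam = 1]. *)
Lemma powR_pos_part_continuous (R : realType) (r : R) : 0 < r ->
  continuous (fun x : R => Num.max x 0 `^ r).
Proof.
move=> r0 x.
have [x0|x0] := ltP 0 x.
  have maxc : {for x, continuous (fun y : R => Num.max y 0)}.
    by apply: (@continuous_max _ _ id (cst 0)); [exact: cvg_id|exact: cvg_cst].
  by apply: cvg_powR => //; rewrite lt_max x0.
apply/cvgrPdist_lt => e e0; rewrite (max_idPr x0) powR0 ?gt_eqF//.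
have d0 : 0 < e `^ r^-1 by exact: powR_gt0.
near=> y.
have yd : `|x - y| < e `^ r^-1.
  by near: y; apply: (@cvgr_dist_lt _ _ _ (nbhs x) _ id).
rewrite sub0r normrN ger0_norm ?powR_ge0//.
have -> : e = (e `^ r^-1) `^ r by rewrite -powRrM mulVf ?gt_eqF// powRr1// ltW.
apply: gt0_ltr_powR; rewrite ?nnegrE ?le_max ?lexx ?orbT ?(ltW d0)//.
rewrite gt_max d0 andbT; apply: le_lt_trans yd.
by rewrite distrC (le_trans _ (ler_norm _))// lerBrDl gerDr.
Unshelve. all: by end_near. Qed.

End Continuity.

Section Interpolation.
Variables (R : realType) (p q : R) (t : nat -> R).
Hypotheses (t_pos : forall k, 0 < t k) (t_noninc : nonincreasing_seq t).
Hypotheses (q_ge1 : 1 <= q) (q_lt_p : q < p).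

Let q_gt0 : 0 < q. Proof. exact: lt_le_trans q_ge1. Qed.
Let p_gt0 : 0 < p. Proof. exact: lt_trans q_lt_p. Qed.
Let pq_gt0 : 0 < p - q. Proof. by rewrite subr_gt0. Qed.
Let powRqK v : 0 <= v -> (v `^ q) `^ q^-1 = v.
Proof. by move=> v0; rewrite -powRrM mulfV ?gt_eqF// powRr1. Qed.

Lemma t_interp_ge0 m lam : 0 <= t_interp q t m lam.
Proof. exact: powR_ge0. Qed.

Lemma t_interp0 m : t_interp q t m 0 = t m.
Proof. by rewrite /t_interp subr0 mul1r mul0r addr0 powRqK// ltW. Qed.

Lemma t_interp1 m : t_interp q t m 1 = t m.-1.
Proof. by rewrite /t_interp subrr mul1r mul0r add0r powRqK// ltW. Qed.

Let tq_le j k : (j <= k)%N -> t k `^ q <= t j `^ q.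
Proof.
by move=> jk; apply: ge0_ler_powR; rewrite ?nnegrE ?(ltW q_gt0) ?(ltW (t_pos _)) ?t_noninc.
Qed.

Lemma t_interp_bounds m lam : 0 <= lam <= 1 ->
  t m <= t_interp q t m lam <= t m.-1.
Proof.
move=> /andP[l0 l1]; have tm := tq_le (leq_pred m).
rewrite -[t m in X in X && _]powRqK ?(ltW (t_pos _))//.
rewrite -[t m.-1 in X in _ && X]powRqK ?(ltW (t_pos _))//.
have pos a b : 0 <= a -> 0 <= b -> a <= b -> a `^ q^-1 <= b `^ q^-1.
  by move=> a0 b0 ab; apply: ge0_ler_powR; rewrite ?nnegrE ?invr_ge0 ?(ltW q_gt0).
have v0 : 0 <= (1 - lam) * t m `^ q + lam * t m.-1 `^ q.
  by rewrite addr_ge0 ?mulr_ge0 ?powR_ge0 ?subr_ge0.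
by rewrite !pos ?powR_ge0//; nra.
Qed.

Lemma t_interp_le m lam : 0 <= lam <= 1 -> forall k, (k < m)%N -> t_interp q t m lam <= t k.
Proof.
move=> lam01 k km; have /andP[_ h] := t_interp_bounds m lam01.
by rewrite (le_trans h)// t_noninc//; case: m km {h}.
Qed.

Lemma t_interp_ge m lam : 0 <= lam <= 1 -> forall k, (m <= k)%N -> t k <= t_interp q t m lam.
Proof.
move=> lam01 k km; have /andP[h _] := t_interp_bounds m lam01.
by rewrite (le_trans _ h)// t_noninc.
Qed.

(** The strict inequality keeps the weight of index 0 positive on the whole
    segment, so that both sums are positive and the outer powers, one of which has
    a negative exponent, are continuous. *)
Lemma radius_interp_IVT m eps : (1 < m)%N -> t m.-1 < t 0%N ->
  radius p q t m (t m) <= eps <= radius p q t m (t m.-1) ->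
  exists2 lam, 0 <= lam <= 1 & eps = radius p q t m (t_interp q t m lam).
Proof.
move=> m1 tm bounds.
pose u (lam : R) := (1 - lam) * t m `^ q + lam * t m.-1 `^ q.
(* On [[0, 1]] the positive parts change nothing. *)
pose v (j : nat) (lam : R) := Num.max (1 - u lam / t j `^ q) 0.
pose D lam := \sum_(j < m) v j lam `^ (p / (p - q)).
pose M lam := \sum_(j < m) (t j `^ q)^-1 * v j lam `^ (q / (p - q)).
pose G lam := D lam `^ p^-1 * M lam `^ (- q^-1).
have u_interp lam : 0 <= lam <= 1 -> t_interp q t m lam `^ q = u lam.
  move=> /andP[l0 l1]; rewrite /t_interp -powRrM mulVf ?gt_eqF// powRr1//.
  by rewrite addr_ge0 ?mulr_ge0 ?powR_ge0 ?subr_ge0.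
have vE lam (j : nat) : 0 <= lam <= 1 -> (j < m)%N ->
    v j lam = weight q t (t_interp q t m lam) j.
  move=> l01 jm; rewrite /v -(u_interp _ l01); apply/max_idPl.
  have := weight_itv t_pos q_ge1 (t_interp_ge0 m lam) (t_interp_le l01 jm).
  by case/andP.
have DE lam : 0 <= lam <= 1 -> D lam = delta_sum p q t m (t_interp q t m lam).
  by move=> l01; apply: eq_bigr => j _; rewrite vE.
have ME lam : 0 <= lam <= 1 -> M lam = mass_sum p q t m (t_interp q t m lam).
  by move=> l01; apply: eq_bigr => j _; rewrite vE.
have GE lam : 0 <= lam <= 1 -> G lam = radius p q t m (t_interp q t m lam).
  by move=> l01; rewrite radiusE -(DE _ l01) -(ME _ l01).
have uc : continuous u.
  move=> x; apply: cvgD; apply: cvgM; do ?exact: cvg_cst; last exact: cvg_id.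
  by apply: cvgB; [exact: cvg_cst|exact: cvg_id].
have vc j r : 0 < r -> continuous (fun lam => v j lam `^ r).
  move=> r0 x; have lin : {for x, continuous (fun lam => 1 - u lam / t j `^ q)}.
    apply: cvgB; first exact: cvg_cst.
    by apply: cvgM; [exact: uc|exact: cvg_cst].
  apply: (@cvg_comp _ _ _ _ (fun y => Num.max y 0 `^ r) _ _ _ lin).
  exact: powR_pos_part_continuous.
have Gc : {within `[0, 1], continuous G}%classic.
  apply: continuous_in_subspaceT => lam; rewrite inE /= in_itv /= => l01.
  have m0 : (0 < m)%N by exact: ltnW.
  have s_lt : t_interp q t m lam < t 0%N.
    by case/andP: (t_interp_bounds m l01) => _ /le_lt_trans; apply.
  have Dc : continuous D.
    by apply: (continuous_big (@add_continuous _)) => j _; apply: vc; exact: divr_gt0.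
  have Mc : continuous M.
    apply: (continuous_big (@add_continuous _)) => j _ x.
    by apply: cvgM; [exact: cvg_cst|apply: vc; exact: divr_gt0].
  apply: cvgM.
  - apply: cvg_powR (Dc lam).
    by rewrite (DE _ l01) delta_sum_gt0// t_interp_ge0.
  - apply: cvg_powR (Mc lam).
    by rewrite (ME _ l01) mass_sum_gt0// t_interp_ge0.
have G0 : G 0 = radius p q t m (t m) 
  by have := GE 0; rewrite lexx ler01 t_interp0; apply.
have G1 : G 1 = radius p q t m (t m.-1) 
  by have := GE 1; rewrite lexx ler01 t_interp1; apply.
have between (a b x : R) : a <= x <= b -> Num.min a b <= x <= Num.max a b.
  by case/andP => ax xb; rewrite ge_min ax le_max xb orbT.
have [|lam] := @IVT R G 0 1 eps ler01 Gc.
  by rewrite G0 G1; exact: between.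
rewrite in_itv /= => l01 <-; exists lam; [exact: l01|exact: GE].
Qed.

Lemma optimal_with_error_interp n m lam eps : (1 <= m <= n)%N -> 0 <= lam <= 1 ->
  0 < eps -> eps = radius p q t m (t_interp q t m lam) ->
  optimal_with_error q (W_class q t) (@info R n eps p)
    (@Phi_interp R q t n m lam) (error_value p q t eps m (t_interp q t m lam)).
Proof.
move=> mn l01 eps_gt0 epsE; have /andP[m0 m_le_n] := mn.
have le := t_interp_le l01; have ge := t_interp_ge l01.
have s0 := t_interp_ge0 m lam; have eps_ge0 := ltW eps_gt0.
apply: optimal_with_error_shrink => //; first exact: le.
  exact: ge.
apply: optimal_error_ge_extremal => //; [|exact: le|by rewrite -epsE|by left].
rewrite lt_neqAle (le _ _ m0) andbT; apply/eqP => s_top.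
(* If [s] were [t 0], the radius would degenerate to 0. *)
move: eps_gt0; rewrite epsE s_top radius_top ?ltxx// => k km.
by apply/le_anti; rewrite (t_le0 t_noninc) -s_top le.
Qed.

End Interpolation.

Theorem theorem4 (R : realType) (p q eps : R) (t : nat -> R) (n : nat)
    (t_pos : forall k, 0 < t k) (t_noninc : nonincreasing_seq t)
    (n_gt0 : (0 < n)%N) (q_ge1 : 1 <= q) (q_lt_p : q < p) (eps_ge0 : 0 <= eps) :
  [/\ (* 1 *)
      eps <= c p q t n ->
        optimal_with_error q (W_class q t) (@info R n eps p)
          (@Phi_full R q t n) (error_value p q t eps n (t n)),
      (* 2 *)
      c p q t n < eps <= c p q t 1 ->
        (exists (m : nat) (lam : R),
          [/\ (1 <= m <= n.-1)%N,
              c p q t m.+1 < eps <= c p q t m,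
              0 < lam <= 1,
              eps = radius p q t m.+1 (t_interp q t m.+1 lam)
                \/ t_interp q t m.+1 lam = t 0%N
            & optimal_with_error q (W_class q t) (@info R n eps p)
                (@Phi_interp R q t n m.+1 lam)
                (error_value p q t eps m.+1 (t_interp q t m.+1 lam))])
        /\
        (forall (m : nat) (lam : R),
          (1 <= m <= n)%N -> 0 <= lam <= 1 ->
          eps = radius p q t m (t_interp q t m lam) ->
          optimal_with_error q (W_class q t) (@info R n eps p)
            (@Phi_interp R q t n m lam)
            (error_value p q t eps m (t_interp q t m lam)))
    & (* 3 *)
      c p q t 1 < eps ->
        optimal_with_error q (W_class q t) (@info R n eps p)
          (@Phi_zero R n) (t 0%N) ].
Proof.
have t_top j : t j <= t 0%N by exact: t_noninc.
have flat j : t j = t 0%N -> forall k, (k <= j)%N -> t k = t 0%N.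
  by move=> tj k kj; apply/le_anti; rewrite t_top -tj t_noninc.
split.
- move=> epsc; apply: optimal_with_error_shrink => //; try exact: ltW.
  + by move=> k /ltnW kn; exact: t_noninc.
  + by move=> k kn; exact: t_noninc.
  have [tn|tn] := ltP (t n) (t 0%N).
    apply: optimal_error_ge_extremal => //.
    * by rewrite n_gt0 leqnn.
    * exact: ltW.
    * by move=> k /ltnW kn; exact: t_noninc.
    * by rewrite -c_eq_radius.
    * by right.
  have tn0 : t n = t 0%N by apply/le_anti; rewrite t_top.
  rewrite tn0 error_value_top//; last by move=> k /ltnW; exact: flat.
  by rewrite -tn0; apply: optimal_error_ge_single => //; left.
- move=> /andP[c_lt eps_le].
  have eps_gt0 : 0 < eps by exact: le_lt_trans (c_ge0 p q t_pos n) c_lt.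
  split; last by move=> m lam mn l01; exact: optimal_with_error_interp.
  have n_gt1 : (1 < n)%N.
    rewrite ltn_neqAle n_gt0 andbT; apply/eqP => n1.
    by move: c_lt; rewrite -n1 ltNge eps_le.
  set conclusion := (ex _).
  (* When the optimal error is [t 0] and [t 0 = t 1], the method with [m = 1] and
     [lam = 1] keeps nothing, since all its weights vanish. *)
  have top : t 1%N = t 0%N -> c p q t 2 < eps ->
      ((t 0%N)%:E <= optimal_error q (W_class q t) (@info R n eps p))%E -> conclusion.
    move=> t1 c2 lower; exists 1%N, 1.
    have s1 : t_interp q t 2 1 = t 0%N by rewrite t_interp1.
    split => //.
    + by rewrite leqnn ltn_predRL.
    + by rewrite c2.
    + by rewrite ltr01 lexx.
    + by right.
    rewrite /Phi_interp s1; apply: optimal_with_error_shrink => //.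
    + exact: ltW.
    + by move=> k k2; rewrite (flat 1%N)// -ltnS.
    + by rewrite error_value_top// => k k2; rewrite (flat 1%N).
  (* The plateau reaches the unobserved coordinate [n]. *)
  have [tn|tn] := ltP (t n) (t 0%N); last first.
    have tn0 : t n = t 0%N by apply/le_anti; rewrite t_top.
    apply: top; first exact: (flat n).
      by rewrite c_top//; exact: (flat n).
    by rewrite -tn0; apply: optimal_error_ge_single => //; left.
  have ex_drop : exists k, t k < t 0%N by exists n.
  case: (ex_minnP ex_drop) => k tk k_min.
  have k_gt0 : (0 < k)%N by case: k tk {k_min} => //; rewrite ltxx.
  have flatk j : (j < k)%N -> t j = t 0%N.
    move=> jk; apply/le_anti; rewrite t_top leNgt; apply/negP => /k_min.
    by rewrite leqNgt jk.
  have kn : (k <= n)%N by exact: k_min.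
  have drop j : (k <= j)%N -> t j < t 0%N by move=> kj; rewrite (le_lt_trans _ tk)// t_noninc.
  (* [k] is the first index after the plateau; below, [c k < eps] means that the
     mass spread over the plateau is within the information error. *)
  have [ck|ck] := ltP (c p q t k) eps.
    have k_gt1 : (1 < k)%N.
      rewrite ltn_neqAle k_gt0 andbT; apply/eqP => k1.
      by move: ck; rewrite -k1 ltNge eps_le.
    apply: top; first exact: flatk.
      move: k_gt1; rewrite leq_eqVlt => /predU1P[->//|k_gt2].
      by rewrite c_top//; exact: flatk.
    apply: (@optimal_error_ge_flat _ p q t _ _ _ n k (t k)) => //.
    * by rewrite k_gt0.
    * exact: ltW.
    * by rewrite -c_eq_radius// ltW.
  (* Among the indices from [k] on, the first with [c] below [eps] is not [k]. *)
  have ex_below : exists i, (k <= i)%N && (c p q t i < eps) by exists n; rewrite kn.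
  case: (ex_minnP ex_below) => i /andP[ki ci] i_min.
  have in_ : (i <= n)%N by apply: i_min; rewrite kn.
  case: i => [|m] in ki ci i_min in_ *; first by move: ki; rewrite leqNgt k_gt0.
  have km : (k <= m)%N.
    move: ki; rewrite leq_eqVlt => /predU1P[km|//].
    by move: ci; rewrite -km ltNge ck.
  have m_gt0 : (0 < m)%N by exact: leq_trans km.
  have cm : eps <= c p q t m.
    rewrite leNgt; apply/negP => cm.
    by have := i_min m; rewrite km cm ltnn => /(_ isT).
  have [|lam l01 epsE] := @radius_interp_IVT _ p q t t_pos t_noninc q_ge1 q_lt_p m.+1 eps m_gt0 (drop _ km).
    rewrite -c_eq_radius ?drop// (ltW ci) /= radius_succ//.
    by rewrite -c_eq_radius ?drop.
  exists m, lam; split => //.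
  + by rewrite m_gt0 -ltnS prednK.
  + by rewrite ci.
  + case/andP: l01 => l0 ->; rewrite andbT lt_neqAle l0 andbT; apply/eqP => lam0.
    move: ci; rewrite epsE -lam0 t_interp0// c_eq_radius ?drop//.
    by rewrite ltxx.
  + by left.
  + exact: optimal_with_error_interp.
- rewrite {1}/c eqxx => t0_lt.
  (* Recovering zero is the shrinking method that keeps no coordinate. *)
  have -> : @Phi_zero R n = @shrink R q t n 0 (t 0%N).
    by apply/funext => a; apply/funext => k; rewrite /Phi_zero /shrink; case: insub.
  rewrite -{2}(@error_value_top _ p q t t_pos q_ge1 q_lt_p eps 0%N)//.
  apply: optimal_with_error_shrink => //; first exact: ltW.
  rewrite error_value_top//; apply: optimal_error_ge_single => //.
  by right; exact: ltW.
Qed.
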